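(* Let $V:\mathbb{R}\to[0,\infty)$ be an optimal velocity function and let $h>0$. Then the delay differential equation $w'(t)=f(w_t)$ does not have any wavefront solutions with constant-speed which are (locally) asymptotically stable.
   Context: Optimal velocity function: $V:\mathbb{R}\to[0,\infty)$ such that (OVF 1) $V$ is non-negative and monotonically increasing (in the weak sense); (OVF 2) $V$ is bounded from above by some $V^{\max}>0$ and $\lim_{s\to\infty}V(s)=V^{\max}$; (OVF 3) there is $d_S\ge0$ such that $V(s)=0$ for all $s\le d_S$ and $V(s)>0$ for all $s>d_S$; (OVF 4) $V$ is $C^1$-smooth, twice continuously differentiable in $(d_S,\infty)$, and there is $b>0$ such that $V'$ is strictly increasing in $(d_S,b)$ and strictly decreasing in $(b,\infty)$. The equation: $C$ is the Banach space of continuous functions $\varphi=(\varphi_1,\varphi_2):[-1,0]\to\mathbb{R}^2$ with norm $\|\varphi\|_C=\sup_{-1\le s\le0}\|\varphi(s)\|_{\mathbb{R}^2}$ (Euclidean norm on $\mathbb{R}^2$). For a continuous $\mathbb{R}^2$-valued function $w$ defined on an interval containing $[t-1,t]$, the segment $w_t\in C$ is $w_t(s)=w(t+s)$, $-1\le s\le0$. The map $f:C\to\mathbb{R}^2$ is $$f(\varphi)=\begin{pmatrix}\varphi_2(0)\\ h^2V(\varphi_1(-1)-\varphi_1(0))+h\,\varphi_2(0)\end{pmatrix}.$$ For each $\varphi\in C$ there is a unique solution $w^\varphi:[-1,\infty)\to\mathbb{R}^2$ of $w'(t)=f(w_t)$ with $w^\varphi_0=\varphi$ (continuous on $[-1,\infty)$,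 continuously differentiable and satisfying the equation for $t>0$). Wavefront solutions: for $c>0$ with $hV(c)=c$ and $d\in\mathbb{R}$, the function $w^{c,d}(t)=(-ct+d,-c)^T$, $t\in\mathbb{R}$, is a solution of $w'(t)=f(w_t)$, called a wavefront solution with constant-speed. Stability: $w^{c,d}$ is stable if for every $\varepsilon>0$ there is $\delta>0$ such that $\|w_0^{c,d}-\varphi\|_C<\delta$, $\varphi\in C$, implies $\|w_t^{c,d}-w_t^\varphi\|_C<\varepsilon$ for all $t\ge0$. It is locally asymptotically stable if it is stable and there is $\varepsilon_a>0$ such that $\|w_0^{c,d}-\varphi\|_C<\varepsilon_a$, $\varphi\in C$, implies $\|w_t^\varphi-w_t^{c,d}\|_C\to0$ as $t\to\infty$. *)

(* Defs.v *)
From Stdlib Require Export Reals.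
From Coquelicot Require Export Coquelicot.

Open Scope R_scope.

(** [Derive] and [Derive_n] are total operators; the [ex_derive] conjuncts
    give them their meaning. *)
Definition optimal_velocity_function (V : R -> R) : Prop :=
  exists Vmax dS b : R,
    ((forall s, 0 <= V s) /\ increasing V) /\
    (0 < Vmax /\ (forall s, V s <= Vmax) /\ is_lim V p_infty Vmax) /\
    (0 <= dS /\ (forall s, s <= dS -> V s = 0) /\ (forall s, dS < s -> 0 < V s)) /\
    ((forall s, ex_derive V s /\ continuous (Derive V) s) /\
     (forall s, dS < s -> ex_derive (Derive V) s /\ continuous (Derive_n V 2) s) /\
     0 < b /\
     (forall x y, dS < x -> x < y -> y < b -> Derive V x < Derive V y) /\
     (forall x y, b < x -> x < y -> Derive V y < Derive V x)).

(** An element of C is represented by a function on all of [R] of which only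
    the restriction to [-1,0] matters. *)
Definition in_C (phi : R -> R * R) : Prop :=
  continuous_on (fun s => -1 <= s <= 0) phi.

(** [norm] is Coquelicot's norm on the product [R * R], which is the Euclidean
    one (lemma [norm_R2]).  The supremum is finite for [phi] in C. *)
Definition normC (phi : R -> R * R) : R :=
  real (Lub_Rbar (fun r => exists s, -1 <= s <= 0 /\ r = norm (phi s))).

Definition distC (phi psi : R -> R * R) : R :=
  normC (fun s => minus (phi s) (psi s)).

Lemma norm_R2 (x y : R) : norm (x, y) = sqrt (x ^ 2 + y ^ 2).
Proof.
  change (sqrt (Rabs x ^ 2 + Rabs y ^ 2) = sqrt (x ^ 2 + y ^ 2)).
  now rewrite !pow2_abs.
Qed.

Definition segment (w : R -> R * R) (t : R) : R -> R * R := fun s => w (t + s).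

Definition rhs (V : R -> R) (h : R) (phi : R -> R * R) : R * R :=
  (snd (phi 0),
   h ^ 2 * V (fst (phi (-1)) - fst (phi 0)) + h * snd (phi 0)).

(** [w] is a solution on [-1, +oo) with initial value [phi]; its values on
    (-oo, -1) are irrelevant.  The last conjunct says that [w'] is continuous
    on (0, +oo). *)
Definition is_solution (V : R -> R) (h : R) (phi w : R -> R * R) : Prop :=
  (forall s, -1 <= s <= 0 -> segment w 0 s = phi s) /\
  continuous_on (fun t => -1 <= t) w /\
  (forall t, 0 < t -> is_derive w t (rhs V h (segment w t))) /\
  (forall t, 0 < t -> continuous (fun r => rhs V h (segment w r)) t).

Definition wavefront (c d : R) : R -> R * R := fun t => (- c * t + d, - c).

(** The solution with initial value [phi] exists and is unique, so it is
    referred to below by quantifying over all [w] with [is_solution V h phi w]. *)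
Definition stable (V : R -> R) (h : R) (w0 : R -> R * R) : Prop :=
  forall eps, 0 < eps -> exists delta, 0 < delta /\
    forall phi, in_C phi -> distC (segment w0 0) phi < delta ->
    forall w, is_solution V h phi w ->
    forall t, 0 <= t -> distC (segment w0 t) (segment w t) < eps.

Definition locally_asymptotically_stable
    (V : R -> R) (h : R) (w0 : R -> R * R) : Prop :=
  stable V h w0 /\
  exists eps_a, 0 < eps_a /\
    forall phi, in_C phi -> distC (segment w0 0) phi < eps_a ->
    forall w, is_solution V h phi w ->
    is_lim (fun t => distC (segment w t) (segment w0 t)) p_infty 0.

(* Main.v *)
Require Import Defs.
From Stdlib Require Import Reals Lra.
From Coquelicot Require Import Coquelicot.
Open Scope R_scope.

(** The right-hand side sees the first component of a segment only through the
    difference of its values at [-1] and [0], so the equation is invariant under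
    adding a constant to the first component.  This translation maps a wavefront
    with offset [d] to the wavefront with the same speed and offset [d + eta].
    Both are solutions, and they stay at distance [|eta|] from each other for
    all times ([distC_wavefront]).  Starting arbitrarily close to the given
    wavefront there is thus a solution that does not approach it: a wavefront is
    never isolated in the family of wavefronts of its speed, and attractivity
    already fails inside that family. *)

(** The headway along a wavefront of speed [c] is constantly [c], because the
    delay is [1]; the condition [h * V c = c] says that the acceleration
    vanishes at this headway. *)
Lemma rhs_wavefront (V : R -> R) (h c d t : R) :
  h * V c = c -> rhs V h (segment (wavefront c d) t) = (- c, 0).
Proof.
  intros Hc. unfold rhs, segment, wavefront; simpl fst; simpl snd.
  replace (- c * (t + -1) + d - (- c * (t + 0) + d)) with c by ring.
  f_equal.
  replace (h ^ 2 * V c + h * - c) with (h * (h * V c - c)) by ring.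
  rewrite Hc. ring.
Qed.

Lemma is_derive_wavefront (c d t : R) :
  is_derive (wavefront c d) t (- c, 0).
Proof.
  split.
  - apply (is_linear_scal_l (K := R_AbsRing)
      (V := prod_NormedModule R_AbsRing R_NormedModule R_NormedModule)).
  - intros x Hx eps. apply (is_filter_lim_locally_unique (V := R_NormedModule)) in Hx. subst x.
    (* An affine map differs from its linearization by zero. *)
    apply filter_forall. intros y.
    match goal with |- norm ?e <= _ =>
      replace e with (zero : prod_NormedModule R_AbsRing R_NormedModule R_NormedModule)
    end.
    + etransitivity; [apply Req_le, norm_zero |].
      apply Rmult_le_pos; [apply Rlt_le, eps | apply norm_ge_0].
    + apply injective_projections; cbv -[Rplus Rmult Ropp IZR]; ring.
Qed.

Lemma continuous_wavefront (c d t : R) : continuous (wavefront c d) t.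
Proof.
  apply (ex_derive_continuous (wavefront c d)).
  eexists. apply is_derive_wavefront.
Qed.

Lemma is_solution_wavefront (V : R -> R) (h c d : R) :
  h * V c = c ->
  is_solution V h (segment (wavefront c d) 0) (wavefront c d).
Proof.
  intros Hc. split; [reflexivity | split; [| split]].
  - apply continuous_on_forall. intros t _. apply continuous_wavefront.
  - intros t _. rewrite rhs_wavefront by exact Hc. apply is_derive_wavefront.
  - intros t _.
    apply (continuous_ext (fun _ => (- c, 0))).
    + intros r. symmetry. now apply rhs_wavefront.
    + apply continuous_const.
Qed.

Lemma normC_const_norm (phi : R -> R * R) (r : R) :
  (forall s, -1 <= s <= 0 -> norm (phi s) = r) -> normC phi = r.
Proof.
  intros Hr. unfold normC.
  rewrite (is_lub_Rbar_unique _ (Finite r)); [reflexivity | split].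
  - intros x [s [Hs ->]]. rewrite Hr by exact Hs. apply Rle_refl.
  - intros M HM. apply HM. exists 0.
    assert (H0 : -1 <= 0 <= 0) by lra.
    split; [exact H0 | symmetry; now apply Hr].
Qed.

Lemma distC_wavefront (c d d' t : R) :
  distC (segment (wavefront c d) t) (segment (wavefront c d') t) = Rabs (d - d').
Proof.
  apply normC_const_norm. intros s _.
  replace (minus _ _) with ((d - d', 0) : R * R).
  - etransitivity; [apply norm_R2 |].
    replace ((d - d') ^ 2 + 0 ^ 2) with (Rsqr (d - d')) by (unfold Rsqr; ring).
    apply sqrt_Rsqr_abs.
  - apply injective_projections; cbv; ring.
Qed.

Lemma in_C_segment_wavefront (c d t : R) : in_C (segment (wavefront c d) t).
Proof.
  apply continuous_on_forall. intros s _.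
  apply (continuous_comp (fun s => t + s) (wavefront c d)).
  - apply (ex_derive_continuous (fun s => t + s)). auto_derive. trivial.
  - apply continuous_wavefront.
Qed.

Theorem proposition5p1 (V : R -> R) (h : R)
    (HV : optimal_velocity_function V) (Hh : 0 < h) :
  ~ exists c d : R,
      0 < c /\ h * V c = c /\
      locally_asymptotically_stable V h (wavefront c d).
Proof.
  intros (c & d & _ & Hc & _ & eps & Heps & Hattr).
  assert (Hlim : is_lim (fun t => distC (segment (wavefront c (d + eps / 2)) t)
                                        (segment (wavefront c d) t)) p_infty 0).
  { apply (Hattr (segment (wavefront c (d + eps / 2)) 0)).
    - apply in_C_segment_wavefront.
    - rewrite distC_wavefront.
      replace (d - (d + eps / 2)) with (- (eps / 2)) by ring.
      rewrite Rabs_Ropp, Rabs_pos_eq; lra.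
    - now apply is_solution_wavefront. }
  apply (is_lim_ext _ (fun _ => eps / 2)) in Hlim.
  - apply is_lim_unique in Hlim. rewrite Lim_const in Hlim.
    injection Hlim. lra.
  - intros t. rewrite distC_wavefront.
    replace (d + eps / 2 - d) with (eps / 2) by ring.
    apply Rabs_pos_eq. lra.
Qed.
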